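(* Let $A$ be a Barbasch–Sahi algebra over a field $\mathbb{F}$ of characteristic $0$, with underlying pointed cocommutative Hopf algebra $H$, orthogonal module $V$, Clifford algebra $C$, Dirac element $D$, and algebra $H'=\tilde H/\ker\Delta_C$, and let $\zeta:Z(A)\to Z(H')$ be the algebra map described in the context. Let $M$ be a finite-dimensional $A$-module with central character $\chi: Z(A)\to\mathbb{F}$ and with non-zero Dirac cohomology $H^D(M)$, and let $(U,\sigma)$ be a non-zero $H'$-submodule of $H^D(M)$. Then $\chi=\sigma\circ\zeta$, i.e. for every $z\in Z(A)$ the element $\zeta(z)$ acts on $U$ as the scalar $\chi(z)$.
   Context: All vector spaces and tensor products are over a field $\mathbb{F}$ of characteristic $0$; modules are left modules. Hopf–Hecke algebras. Let $H$ be a cocommutative Hopf algebra with counit $\varepsilon$, coproduct $\Delta(h)=h_{(1)}\otimes h_{(2)}$ (Sweedler notation) and antipode $S$. Let $V$ be a finite-dimensional orthogonal $H$-module, i.e. $V$ carries a (fixed) non-degenerate symmetric bilinear form $\langle\cdot,\cdot\rangle$ with $\langle h_{(1)}\cdot v,h_{(2)}\cdot w\rangle=\varepsilon(h)\langle v,w\rangle$ for all $h\in H$, $v,w\in V$. Let $T(V)\rtimes H$ be the smash product, the algebra generated by $T(V)$ and $H$ with relations $hv=(h_{(1)}\cdot v)h_{(2)}$. Let $\kappa:V\wedge V\to H$ be linear, let $I_\kappa$ be the ideal generated by all $vw-wv-\kappa(v\wedge w)$, $v,w\in V$, and $A=(T(V)\rtimes H)/I_\kappa$. $A$ is called a Hopf–Hecke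 algebra if it has the PBW property: the natural surjection from $S(V)\rtimes H$ to the associated graded algebra of $A$ (for the filtration coming from $T(V)$) is an isomorphism. Let $C=C(V)$ be the quotient of $T(V)$ by the ideal generated by all $vw+wv-2\langle v,w\rangle$; it has its usual $\mathbb{Z}_2$-gradation, with $V$ odd, and $A\otimes C$ inherits a $\mathbb{Z}_2$-gradation from $C$. The Dirac element is $D=\sum_i v_i\otimes v^i\in A\otimes C$ for any pair $(v_i)_i,(v^i)_i$ of dual bases of $V$ with respect to $\langle\cdot,\cdot\rangle$. Pin cover. Assume $H$ is pointed (every simple subcoalgebra is one-dimensional). Let $G=G(H)$ be the group of group-like elements and $L=P(H)$ the Lie algebra of primitive elements, so $H=\mathcal{U}(L)\rtimes\mathbb{F}[G]$. The algebra $H$ is $\mathbb{Z}_2$-graded by $(-1)^{|g|}=\det(g|_V)$ for $g\in G$ and $(-1)^{|x|}=1$ for $x\in L$. The pin cover of $H$ with respect to $V$ is a triple $(\tilde H,\pi,\gamma)$ where $\tilde H$ is a pointed cocommutative Hopf algebra, $\pi:\tilde H\to H$ is a Hopf algebra epimorphism and $\gamma:\tilde H\to C$ is an algebra map, such that: $(\tilde H,\pi)$ is a double cover of $H$ ($\tilde H\cong H\oplus H$ as coalgebras and $\pi$ restricts to a coalgebra isomorphism on each copy of $H$); $\gamma$ preserves the $\mathbb{Z}_2$-gradation (where $\tilde H$ is graded by the same recipe as $H$, using that $V$ is an orthogonal $\tilde H$-module via $\pi$); and $(-1)^{|\tilde h|}\pi(\tilde h)\cdot v=\gamma(\tilde h_{(1)})\,v\,\gamma(S\tilde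 h_{(2)})$ in $C$ for all homogeneous $\tilde h\in\tilde H$, $v\in V$. Concretely, $\tilde H=\mathcal{U}(L)\rtimes\mathbb{F}[\tilde G]$, where $\tilde G$, $\pi|_{\tilde G}:\tilde G\to G$ and $\gamma|_{\tilde G}:\tilde G\to\mathrm{Pin}(V)$ form the pullback of $G\to O(V)$ and the map $\mathrm{Pin}(V)\to O(V)$ sending a unit vector $v$ to the reflection $\tau_v$ ($\mathrm{Pin}(V)\subset C^\times$ is the subgroup generated by all $v\in V$ with $\langle v,v\rangle=1$), $\tilde G$ acts on $L$ via $G$, $\pi|_L=\mathrm{id}$, and $\gamma|_L$ maps $x\in L$ to the unique element $\gamma(x)$ in the span of the elements $vw-wv$ with $[\gamma(x),u]=x\cdot u$ for all $u\in V$. The diagonal map is the algebra map $\Delta_C:\tilde H\to H\otimes C\subset A\otimes C$, $\Delta_C(\tilde h)=\pi(\tilde h_{(1)})\otimes\gamma(\tilde h_{(2)})$, and $H':=\tilde H/\ker\Delta_C$; the induced injective map $H'\to A\otimes C$ is also denoted $\Delta_C$. $D$ satisfies the Parthasarathy condition if $D^2\in Z(A\otimes C)+\Delta_C(\tilde H^{\mathrm{even}})$, where $Z(\cdot)$ denotes the center. A Hopf–Hecke algebra whose Dirac element satisfies the Parthasarathy condition is called a Barbasch–Sahi algebra. The map $\zeta$. $\tilde H$ acts on $A\otimes C$ by $\tilde h\cdot x=\Delta_C(\tilde h_{(1)})\,x\,\Delta_C(S\tilde h_{(2)})$; let $(A\otimes C)_{\mathrm{det}}$ be the subspace on which each homogeneous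 $\tilde h$ acts as $(-1)^{|\tilde h|}\varepsilon(\tilde h)$. For a Barbasch–Sahi algebra, each $z\in Z(A)$ determines a unique $\zeta(z)\in Z(H')$ such that $z\otimes1=\Delta_C(\zeta(z))+Da+aD$ for some odd $a\in(A\otimes C)_{\mathrm{det}}$; this defines an algebra map $\zeta:Z(A)\to Z(H')$. Dirac cohomology. Fix a spin module $\mathcal{S}$ of $C$. For an $A$-module $M$, $M\otimes\mathcal{S}$ is an $A\otimes C$-module, so $D$ acts on it, and $H^D(M):=\ker D/(\ker D\cap\operatorname{im}D)$. It is an $H'$-module via the action of $\tilde h\in\tilde H$ on $M\otimes\mathcal{S}$ by $\Delta_C(\tilde h)$. $M$ has central character $\chi$ if each $z\in Z(A)$ acts on $M$ as the scalar $\chi(z)$. *)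

(* Defs.v *)
From HB Require Import structures.
From mathcomp Require Import all_boot all_order all_algebra.
From mathcomp Require Import finmap boolp.
From mathcomp.multinomials Require Import monalg.

Set Implicit Arguments.
Unset Strict Implicit.
Unset Printing Implicit Defensive.

Import GRing.Theory.
Local Open Scope ring_scope.
Local Open Scope quotient_scope.
Local Open Scope fset_scope.
Local Open Scope ring_scope.

(* MathComp's [algType] excludes the zero algebra, which cannot be ruled out
   for an algebra given by generators and relations. *)
HB.mixin Record Lmodule_isPzAlgebra (F : fieldType) A of GRing.Lmodule F A := {
  pzone : A;
  pzmul : A -> A -> A;
  pzmulA : associative pzmul;
  pzmul1 : left_id pzone pzmul;
  pzmulr1 : right_id pzone pzmul;
  pzmulDl : left_distributive pzmul +%R;
  pzmulDr : right_distributive pzmul +%R;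
  pzmulZl : forall (a : F) (x y : A), a *: pzmul x y = pzmul (a *: x) y;
  pzmulZr : forall (a : F) (x y : A), a *: pzmul x y = pzmul x (a *: y)
}.

#[short(type="pzAlgType")]
HB.structure Definition PzAlgebra (F : fieldType) :=
  {A of GRing.Lmodule F A & Lmodule_isPzAlgebra F A}.

HB.instance Definition _ (F : fieldType) (A : pzAlgType F) :=
  GRing.Zmodule_isPzRing.Build (PzAlgebra.sort A)
    (@pzmulA F A) (@pzmul1 F A) (@pzmulr1 F A) (@pzmulDl F A) (@pzmulDr F A).

Lemma pzscalerAl (F : fieldType) (A : pzAlgType F) (a : F) (x y : A) :
  a *: (x * y) = (a *: x) * y.
Proof. exact: pzmulZl. Qed.
Lemma pzscalerAr (F : fieldType) (A : pzAlgType F) (a : F) (x y : A) :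
  a *: (x * y) = x * (a *: y).
Proof. exact: pzmulZr. Qed.

Section Spans.
Context (F : fieldType) (U : lmodType F).

Inductive lspan (P : U -> Prop) : U -> Prop :=
| lspan0 : lspan P 0
| lspan_lin a u v : P u -> lspan P v -> lspan P (a *: u + v).

Definition subspace (X : U -> Prop) : Prop :=
  X 0 /\ forall a u v, X u -> X v -> X (a *: u + v).

Lemma lspan_subspace P : subspace (lspan P).
Proof.
split=> [|a u v Pu Pv]; first exact: lspan0.
elim: Pu => [|b u1 u2 Pu1 _ IH]; first by rewrite scaler0 add0r.
by rewrite scalerDr scalerA -addrA; apply: lspan_lin.
Qed.

Lemma lspan_incl (P : U -> Prop) u : P u -> lspan P u.
Proof.
by move=> Pu; rewrite -[u]addr0 -[u]scale1r; apply: lspan_lin => //; apply: lspan0.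
Qed.

Lemma lspan_min (P X : U -> Prop) :
  subspace X -> (forall u, P u -> X u) -> forall u, lspan P u -> X u.
Proof.
by move=> [X0 XD] PX u; elim=> // a v w /PX Xv _ Xw; apply: XD.
Qed.

Definition lspanb (P : U -> Prop) : {pred U} := fun u => `[< lspan P u >].

Lemma lspanb_zmod P : zmod_closed (lspanb P).
Proof.
have [P0 PD] := lspan_subspace P; split=> [|u v /asboolP Pu /asboolP Pv].
  exact/asboolP.
by apply/asboolP; rewrite addrC -scaleN1r; apply: PD.
Qed.
HB.instance Definition _ P := GRing.isZmodClosed.Build U (lspanb P) (lspanb_zmod P).
End Spans.

Section QuotMod.
Context (F : fieldType) (U : lmodType F) (P : U -> Prop).

Definition quotMod := Quotient.quot (lspanb P : zmodClosed U).
HB.instance Definition _ := GRing.Zmodule.on quotMod.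
Definition qmod (u : U) : quotMod := \pi_(Quotient.quot (lspanb P : zmodClosed U)) u.
Definition qrepr (x : quotMod) : U := repr x.
Lemma qreprK x : qmod (qrepr x) = x. Proof. exact: reprK. Qed.
Lemma qmod_eq u v : qmod u = qmod v <-> lspan P (u - v).
Proof.
rewrite /qmod; split=> [/eqP|Puv].
  by rewrite -Quotient.idealrBE => /asboolP.
by apply/eqP; rewrite -Quotient.idealrBE; apply/asboolP.
Qed.
Lemma qmodD u v : qmod (u + v) = qmod u + qmod v.
Proof. by rewrite /qmod !piE. Qed.

Definition qscale (a : F) (x : quotMod) : quotMod := qmod (a *: qrepr x).
Lemma qmod_scale a u : qmod (a *: u) = qscale a (qmod u).
Proof.
apply/qmod_eq; rewrite -scalerBr -[_ *: _]addr0.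
have [P0 PD] := lspan_subspace P; apply: PD => //.
by apply/qmod_eq; rewrite qreprK.
Qed.
Fact qscaleA a b x : qscale a (qscale b x) = qscale (a * b) x.
Proof. by rewrite -[x]qreprK -!qmod_scale scalerA. Qed.
Fact qscale1 : left_id 1 qscale.
Proof. by move=> x; rewrite -[x]qreprK -!qmod_scale scale1r. Qed.
Fact qscaleDr : right_distributive qscale +%R.
Proof.
by move=> a x y; rewrite -[x]qreprK -[y]qreprK -!(qmodD, qmod_scale) scalerDr.
Qed.
Fact qscaleDl x : {morph qscale^~ x : a b / a + b}.
Proof.
by move=> a b; rewrite -[x]qreprK -!(qmod_scale, qmodD) scalerDl.
Qed.
HB.instance Definition _ := GRing.Zmodule_isLmodule.Build F quotMod
  qscaleA qscale1 qscaleDr qscaleDl.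
Lemma qmod_linear : linear qmod.
Proof. by move=> a u v; rewrite qmodD qmod_scale. Qed.
HB.instance Definition _ := GRing.isLinear.Build F U quotMod _ qmod qmod_linear.
Lemma qmodZ a u : qmod (a *: u) = a *: qmod u. Proof. exact: qmod_scale. Qed.
End QuotMod.

Section QuotAlg.
Context (F : fieldType) (A : pzAlgType F) (R : A -> Prop).

Definition ideal_elt (x : A) : Prop := exists a r b, R r /\ x = a * r * b.
(* The quotient of A by the two-sided ideal generated by R. *)
Definition quotAlg := quotMod ideal_elt.
HB.instance Definition _ := GRing.Lmodule.on quotAlg.
Definition qalg (a : A) : quotAlg := qmod ideal_elt a.

Lemma qalg_rel a b : R (a - b) -> qalg a = qalg b.
Proof.
move=> Rab; apply/qmod_eq; apply: lspan_incl; exists 1, (a - b), 1.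
by rewrite mul1r mulr1.
Qed.

Lemma ideal_mul a x b : lspan ideal_elt x -> lspan ideal_elt (a * x * b).
Proof.
elim=> [|c u v [a' [r [b' [Rr ->]]]] _ IH].
  by rewrite mulr0 mul0r; apply: lspan0.
rewrite mulrDr mulrDl -pzscalerAr -pzscalerAl; apply: lspan_lin => //.
by exists (a * a'), r, (b' * b); rewrite !mulrA.
Qed.

Definition qmul (x y : quotAlg) : quotAlg := qalg (qrepr x * qrepr y).
Lemma qalgM_qmul a b : qalg (a * b) = qmul (qalg a) (qalg b).
Proof.
apply/qmod_eq; set a' := qrepr _; set b' := qrepr _.
have ha : lspan ideal_elt (a - a') by apply/qmod_eq; rewrite qreprK.
have hb : lspan ideal_elt (b - b') by apply/qmod_eq; rewrite qreprK.
have -> : a * b - a' * b' = 1 *: (1 * (a - a') * b) + a' * (b - b') * 1.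
  by rewrite scale1r mul1r mulr1 mulrBl mulrBr addrA subrK.
by have [P0 PD] := lspan_subspace ideal_elt; apply: PD; apply: ideal_mul.
Qed.
Lemma qalg_reprK (x : quotAlg) : qalg (qrepr x) = x. Proof. exact: qreprK. Qed.
Lemma qalg_ind (Q : quotAlg -> Prop) : (forall a, Q (qalg a)) -> forall x, Q x.
Proof. by move=> Qa x; rewrite -[x]qalg_reprK. Qed.
Let qalgD a b : qalg (a + b) = qalg a + qalg b. Proof. exact: qmodD. Qed.
Let qalgZ c b : qalg (c *: b) = c *: qalg b. Proof. exact: qmodZ. Qed.
Fact qmulA : associative qmul.
Proof.
move=> x y z; rewrite -[x]qalg_reprK -[y]qalg_reprK -[z]qalg_reprK.
by rewrite -!qalgM_qmul mulrA.
Qed.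
Fact qmul1 : left_id (qalg 1) qmul.
Proof. by move=> x; rewrite -[x]qalg_reprK -qalgM_qmul mul1r. Qed.
Fact qmulr1 : right_id (qalg 1) qmul.
Proof. by move=> x; rewrite -[x]qalg_reprK -qalgM_qmul mulr1. Qed.
Fact qmulDl : left_distributive qmul +%R.
Proof.
move=> x y z; rewrite -[x]qalg_reprK -[y]qalg_reprK -[z]qalg_reprK.
by rewrite -!(qalgM_qmul, qalgD) mulrDl.
Qed.
Fact qmulDr : right_distributive qmul +%R.
Proof.
move=> x y z; rewrite -[x]qalg_reprK -[y]qalg_reprK -[z]qalg_reprK.
by rewrite -!(qalgM_qmul, qalgD) mulrDr.
Qed.
Fact qscalerAl (a : F) (x y : quotAlg) : a *: qmul x y = qmul (a *: x) y.
Proof.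
elim/qalg_ind: x => x; elim/qalg_ind: y => y.
by rewrite -[qmul (qalg x) _]qalgM_qmul -!qalgZ -qalgM_qmul pzscalerAl.
Qed.
Fact qscalerAr (a : F) (x y : quotAlg) : a *: qmul x y = qmul x (a *: y).
Proof.
elim/qalg_ind: x => x; elim/qalg_ind: y => y.
by rewrite -[qmul _ (qalg y)]qalgM_qmul -!qalgZ -qalgM_qmul pzscalerAr.
Qed.
HB.instance Definition _ := Lmodule_isPzAlgebra.Build F quotAlg
  qmulA qmul1 qmulr1 qmulDl qmulDr qscalerAl qscalerAr.
HB.instance Definition _ := GRing.PzRing.copy quotAlg
  (PzAlgebra.sort (PzAlgebra.clone F quotAlg _)).

Lemma qalg_linear : linear qalg. Proof. exact: qmod_linear. Qed.
Lemma qalg_monoid : monoid_morphism qalg.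
Proof. by split=> // x y; rewrite qalgM_qmul. Qed.
HB.instance Definition _ := GRing.isLinear.Build F A quotAlg _ qalg qalg_linear.
HB.instance Definition _ := GRing.isMonoidMorphism.Build A quotAlg qalg qalg_monoid.
End QuotAlg.

Section FreeAlg.
Context (F : fieldType) (X : choiceType).

Definition freeAlg := {malg F[{fmonom X}]}.
HB.instance Definition _ := GRing.Lalgebra.on freeAlg.
Fact freeAlgZr (a : F) (x y : freeAlg) : a *: (x * y) = x * (a *: y).
Proof.
rewrite (malgME x y) (malgMEw (fsubset_refl (msupp x)) (msuppZ_le a y)).
rewrite scaler_sumr; apply: eq_bigr => k1 _; rewrite scaler_sumr.
apply: eq_bigr => k2 _; rewrite mcoeffZ; apply/malgP => k.
by rewrite mcoeffZ !mcoeffU mulrCA mulrnAr.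
Qed.
HB.instance Definition _ := Lmodule_isPzAlgebra.Build F freeAlg
  (@mulrA freeAlg) (@mul1r freeAlg) (@mulr1 freeAlg) (@mulrDl freeAlg)
  (@mulrDr freeAlg) (@scalerAl F freeAlg) freeAlgZr.
Definition fgen (x : X) : freeAlg := << fmu x >>.
End FreeAlg.

Section LinearExtension.
Context (F : fieldType) (K : choiceType) (W : lmodType F) (f : K -> W).

Definition mlin (g : {malg F[K]}) : W := \sum_(k <- msupp g) g@_k *: f k.

Lemma mlinEw (d : {fset K}) g : msupp g `<=` d ->
  mlin g = \sum_(k <- d) g@_k *: f k.
Proof.
move=> le; rewrite /mlin (big_fset_incl _ le) => //= x xd /mcoeff_outdom ->.
by rewrite scale0r.
Qed.
Lemma mlin_linear : linear mlin.
Proof.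
move=> a g1 g2; pose d := (msupp g1 `|` msupp g2 `|` msupp (a *: g1 + g2))%fset.
rewrite !(@mlinEw d) ?fsubsetUr //.
- rewrite scaler_sumr -big_split /=; apply: eq_bigr => k _.
  by rewrite mcoeffD mcoeffZ scalerDl scalerA.
- by rewrite /d -fsetUA fsetUCA fsubsetUl.
- by rewrite /d -fsetUA fsubsetUl.
Qed.
Lemma mlinU k : mlin << k >> = f k.
Proof. by rewrite (mlinEw msuppU_le) big_seq_fset1 mcoeffUU scale1r. Qed.
End LinearExtension.

Lemma malg_span (F : fieldType) (K : choiceType) (g : {malg F[K]}) :
  g = mlin (fun k => << k >>) g.
Proof.
rewrite {1}[g]monalgE; apply: eq_bigr => k _; apply/malgP => k'.
by rewrite mcoeffZ !mcoeffU mulrnAr mulr1.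
Qed.

Section Tensor.
Context (F : fieldType).

Definition bilin (U V W : lmodType F) (f : U -> V -> W) : Prop :=
  (forall v, linear (f^~ v)) /\ (forall u, linear (f u)).

Section Def.
Context (U V : lmodType F).
Implicit Types W : lmodType F.

Variant tensor_rel : {malg F[(U * V)%type]} -> Prop :=
| tensor_rel_l a u1 u2 v :
    tensor_rel (<< (a *: u1 + u2, v) >> - (a *: << (u1, v) >> + << (u2, v) >>))
| tensor_rel_r a u v1 v2 :
    tensor_rel (<< (u, a *: v1 + v2) >> - (a *: << (u, v1) >> + << (u, v2) >>)).

Definition tensor := quotMod tensor_rel.
HB.instance Definition _ := GRing.Lmodule.on tensor.
Definition tens (u : U) (v : V) : tensor := qmod tensor_rel << (u, v) >>.

Lemma tens_bilin : bilin tens.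
Proof.
split=> [v a u1 u2|u a v1 v2]; apply: etrans (qmod_linear _ _ _ _);
  apply/qmod_eq; apply: lspan_incl; [exact: tensor_rel_l|exact: tensor_rel_r].
Qed.

(* [tlift f] is the linear map induced by a bilinear [f]; it is evaluated on a
   chosen representative, so it is meaningful only for bilinear [f]. A Sweedler
   expression in h(1), h(2) is written [tlift (fun h1 h2 => _) (Delta h)]. *)
Definition tlift (W : lmodType F) (f : U -> V -> W) (t : tensor) : W :=
  mlin (fun p => f p.1 p.2) (qrepr t).

Lemma tlift_qmod W (f : U -> V -> W) (g : {malg F[(U * V)%type]}) : bilin f ->
  tlift f (qmod tensor_rel g) = mlin (fun p => f p.1 p.2) g.
Proof.
move=> [fl fr]; pose L := GRing.isLinear.Build _ _ _ _ _
  (mlin_linear (fun p : (U * V)%type => f p.1 p.2)).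
pose h : {linear {malg F[(U * V)%type]} -> W} := HB.pack (mlin (fun p : (U * V)%type => f p.1 p.2)) L.
have h0 x : lspan tensor_rel x -> h x = 0.
  elim=> [|a u v]; first exact: linear0.
  by case=> [b u1 u2 w|b w v1 v2] _ IH;
    rewrite linearP IH addr0 linearB linearP /= !mlinU /= ?fl ?fr subrr scaler0.
apply/eqP; rewrite -subr_eq0; apply/eqP; rewrite -[LHS]/(h (qrepr (qmod tensor_rel g)) - h g).
by rewrite -linearB h0 //; apply/qmod_eq; rewrite qreprK.
Qed.

Lemma tlift_linear W (f : U -> V -> W) : bilin f -> linear (tlift f).
Proof.
move=> fb a s t; rewrite -[s]qreprK -[t]qreprK -qmod_linear !tlift_qmod //.
exact: mlin_linear.
Qed.

Lemma tlift_tens W (f : U -> V -> W) u v : bilin f -> tlift f (tens u v) = f u v.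
Proof. by move=> fb; rewrite tlift_qmod // mlinU. Qed.

Lemma tens_ind (Q : tensor -> Prop) : Q 0 ->
  (forall a u v t, Q t -> Q (a *: tens u v + t)) -> forall t, Q t.
Proof.
move=> Q0 QD t; rewrite -[t]qreprK [qrepr t]malg_span /mlin.
elim: (msupp _ : seq _) => [|[u v] s IH].
  by rewrite big_nil; have -> : qmod tensor_rel 0 = 0 by exact: linear0.
by rewrite big_cons qmod_linear; apply: QD.
Qed.

Lemma tlift_eq W (f g : U -> V -> W) :
  (forall u v, f u v = g u v) -> tlift f =1 tlift g.
Proof. by move=> fg t; apply: eq_bigr => k _; rewrite fg. Qed.
Lemma tlift_linear_fun W a (f g : U -> V -> W) t :
  tlift (fun u v => a *: f u v + g u v) t = a *: tlift f t + tlift g t.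
Proof.
rewrite /tlift /mlin scaler_sumr -big_split /=; apply: eq_bigr => k _.
by rewrite scalerDr !scalerA mulrC.
Qed.
End Def.

Definition tmap (U V U' V' : lmodType F) (f : U -> U') (g : V -> V') :
    tensor U V -> tensor U' V' :=
  tlift (fun u v => tens (f u) (g v)).
Definition tswap (U V : lmodType F) : tensor U V -> tensor V U :=
  tlift (fun u v => tens v u).
Definition tassoc (U V W : lmodType F) :
    tensor (tensor U V) W -> tensor U (tensor V W) :=
  tlift (fun t w => tlift (fun u v => tens u (tens v w)) t).
End Tensor.

Section BilinearMul.
Context (F : fieldType) (T : lmodType F) (I : Type) (g : I -> T).
Hypothesis Tind : forall Q : T -> Prop, Q 0 ->
  (forall a i t, Q t -> Q (a *: g i + t)) -> forall t, Q t.
Variable m : T -> T -> T.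
Hypothesis mb : bilin m.
Let ml c s t u : m (c *: s + t) u = c *: m s u + m t u. Proof. exact: mb.1. Qed.
Let mr c s t u : m u (c *: s + t) = c *: m u s + m u t. Proof. exact: mb.2. Qed.
Lemma bilin0l t : m 0 t = 0.
Proof. by have := ml (-1) 0 0 t; rewrite scaler0 addr0 scaleN1r addNr. Qed.
Lemma bilin0r t : m t 0 = 0.
Proof. by have := mr (-1) 0 0 t; rewrite scaler0 addr0 scaleN1r addNr. Qed.
Lemma bilinA : (forall i j k, m (g i) (m (g j) (g k)) = m (m (g i) (g j)) (g k)) ->
  associative m.
Proof.
move=> gA; elim/Tind => [|c i s IH] t u; first by rewrite !bilin0l.
rewrite !ml IH; congr (_ *: _ + _) => {IH}.
elim/Tind: t => [|d j t IH]; first by rewrite !(bilin0l, bilin0r).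
rewrite !(ml, mr) IH; congr (_ *: _ + _) => {IH}.
elim/Tind: u => [|e k u IH]; first by rewrite !bilin0r.
by rewrite !mr IH gA.
Qed.
Lemma bilin1l e : (forall i, m e (g i) = g i) -> left_id e m.
Proof.
by move=> ge; elim/Tind => [|c i t IH]; rewrite ?bilin0r // mr IH ge.
Qed.
Lemma bilin1r e : (forall i, m (g i) e = g i) -> right_id e m.
Proof.
by move=> ge; elim/Tind => [|c i t IH]; rewrite ?bilin0l // ml IH ge.
Qed.
Lemma bilinDl : left_distributive m +%R.
Proof. by move=> s t u; have := ml 1 s t u; rewrite !scale1r. Qed.
Lemma bilinDr : right_distributive m +%R.
Proof. by move=> s t u; have := mr 1 t u s; rewrite !scale1r. Qed.
Lemma bilinZl c s t : c *: m s t = m (c *: s) t.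
Proof. by have := ml c s 0 t; rewrite bilin0l !addr0. Qed.
Lemma bilinZr c s t : c *: m s t = m s (c *: t).
Proof. by have := mr c t 0 s; rewrite bilin0r !addr0. Qed.
End BilinearMul.

Section TensorAlg.
Context (F : fieldType) (A B : pzAlgType F).

Definition tmul (s t : tensor A B) : tensor A B :=
  tlift (fun (a : A) (b : B) => tlift (fun (a' : A) (b' : B) => tens (a * a') (b * b')) t) s.

Let mulP (a : A) (b : B) :
  bilin (fun (a' : A) (b' : B) => tens (a * a') (b * b') : tensor A B).
Proof.
have [tl tr] := tens_bilin A B; split=> [b'|a'] c x y /=.
  by rewrite mulrDr -pzscalerAr tl.
by rewrite mulrDr -pzscalerAr tr.
Qed.
Let tmulP (t : tensor A B) :
  bilin (fun (a : A) (b : B) => tlift (fun (a' : A) (b' : B) => tens (a * a') (b * b')) t : tensor A B).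
Proof.
have [tl tr] := tens_bilin A B; split=> [b|a] c x y /=;
  rewrite -tlift_linear_fun; apply: tlift_eq => a' b' /=.
  by rewrite mulrDl -pzscalerAl tl.
by rewrite mulrDl -pzscalerAl tr.
Qed.
Lemma tmul_tens (a : A) (b : B) (a' : A) (b' : B) :
  tmul (tens a b) (tens a' b') = tens (a * a') (b * b').
Proof. by rewrite /tmul !tlift_tens. Qed.
Fact tmulPl t : linear (tmul^~ t).
Proof. exact: tlift_linear. Qed.
Fact tmulPr s : linear (tmul s).
Proof.
move=> c t1 t2; rewrite /tmul -tlift_linear_fun; apply: tlift_eq => a b.
exact: tlift_linear.
Qed.
Fact tmul_bilin : bilin tmul.
Proof. by split=> t; [exact: tmulPl|exact: tmulPr]. Qed.
Let tens_ind' (Q : tensor A B -> Prop) : Q 0 ->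
  (forall a (p : A * B) t, Q t -> Q (a *: tens p.1 p.2 + t)) -> forall t, Q t.
Proof. by move=> Q0 QD; apply: tens_ind => // a u v; apply: (QD a (u, v)). Qed.
Fact tmulA : associative tmul.
Proof.
apply: (bilinA tens_ind' tmul_bilin) => i j k; rewrite !tmul_tens.
by congr tens; apply: mulrA.
Qed.
Fact tmul1 : left_id (tens (1 : A) (1 : B)) tmul.
Proof.
apply: (bilin1l tens_ind' tmul_bilin) => i; rewrite tmul_tens.
by congr tens; apply: mul1r.
Qed.
Fact tmulr1 : right_id (tens (1 : A) (1 : B)) tmul.
Proof.
apply: (bilin1r tens_ind' tmul_bilin) => i; rewrite tmul_tens.
by congr tens; apply: mulr1.
Qed.
HB.instance Definition _ := Lmodule_isPzAlgebra.Build F (tensor A B)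
  tmulA tmul1 tmulr1 (bilinDl tmul_bilin) (bilinDr tmul_bilin)
  (bilinZl tmul_bilin) (bilinZr tmul_bilin).
HB.instance Definition _ := GRing.PzRing.copy (tensor A B)
  (PzAlgebra.sort (PzAlgebra.clone F (tensor A B) _)).
Lemma tensM (a a' : A) (b b' : B) : tens a b * tens a' b' = tens (a * a') (b * b').
Proof. exact: tmul_tens. Qed.
End TensorAlg.


Section Algebras.
Context (F : fieldType).

Definition alg_morphism (A B : pzAlgType F) (f : A -> B) : Prop :=
  linear f /\ monoid_morphism f.

Definition central (A : pzAlgType F) (z : A) : Prop := forall a, z * a = a * z.

Definition alg_action (A : pzAlgType F) (M : lmodType F) (act : A -> M -> M) :
    Prop :=
  [/\ bilin act, forall m, act 1 m = m
    & forall a b m, act (a * b) m = act a (act b m)].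

Definition simple_module (A : pzAlgType F) (M : lmodType F) (act : A -> M -> M) :
    Prop :=
  [/\ alg_action act, exists m : M, m <> 0
    & forall N : M -> Prop, subspace N -> (forall a m, N m -> N (act a m)) ->
      (exists2 m, N m & m <> 0) -> forall m, N m].

Definition tensor_action (A B : pzAlgType F) (M N : lmodType F)
    (actM : A -> M -> M) (actN : B -> N -> N) (t : tensor A B) (x : tensor M N) :
    tensor M N :=
  tlift (fun a b => tmap (actM a) (actN b) x) t.

Definition tensAlg (V : lmodType F) : pzAlgType F :=
  quotAlg (fun r : freeAlg F V => exists (a : F) (v w : V),
    r = fgen F (a *: v + w) - (a *: fgen F v + fgen F w)).
Definition tens_gen (V : lmodType F) (v : V) : tensAlg V := qalg _ (fgen F v).

Definition symAlg (V : lmodType F) : pzAlgType F :=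
  quotAlg (fun r : tensAlg V => exists v w : V,
    r = tens_gen v * tens_gen w - tens_gen w * tens_gen v).
Definition sym_gen (V : lmodType F) (v : V) : symAlg V := qalg _ (tens_gen v).

Definition clifford (V : lmodType F) (form : V -> V -> F) : pzAlgType F :=
  quotAlg (fun r : tensAlg V => exists v w : V,
    r = tens_gen v * tens_gen w + tens_gen w * tens_gen v
        - (2 * form v w) *: (1 : tensAlg V)).
Definition cl_gen (V : lmodType F) (form : V -> V -> F) (v : V) :
  clifford form := qalg _ (tens_gen v).

Definition cl_deg (V : lmodType F) (form : V -> V -> F) (b : bool) :
    clifford form -> Prop :=
  lspan (fun c => exists2 vs : seq V, odd (size vs) = b
                                    & c = \prod_(v <- vs) cl_gen form v).

(* The algebra generated by two algebras, with no relation between them. *)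
Variant freeProd_rel (A B : pzAlgType F) : freeAlg F (A + B)%type -> Prop :=
| freeProd_linl (c : F) (a a' : A) :
    freeProd_rel (fgen F (inl (c *: a + a'))
                  - (c *: fgen F (inl a) + fgen F (inl a')))
| freeProd_mull (a a' : A) :
    freeProd_rel (fgen F (inl (a * a')) - fgen F (inl a) * fgen F (inl a'))
| freeProd_onel : freeProd_rel (fgen F (inl 1) - 1)
| freeProd_linr (c : F) (b b' : B) :
    freeProd_rel (fgen F (inr (c *: b + b'))
                  - (c *: fgen F (inr b) + fgen F (inr b')))
| freeProd_mulr (b b' : B) :
    freeProd_rel (fgen F (inr (b * b')) - fgen F (inr b) * fgen F (inr b'))
| freeProd_oner : freeProd_rel (fgen F (inr 1) - 1).
Definition freeProd (A B : pzAlgType F) : pzAlgType F :=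
  quotAlg (@freeProd_rel A B).
Definition freeProdl (A B : pzAlgType F) (a : A) : freeProd A B :=
  qalg _ (fgen F (inl a)).
Definition freeProdr (A B : pzAlgType F) (b : B) : freeProd A B :=
  qalg _ (fgen F (inr b)).
End Algebras.

Section HopfAlgebras.
Context (F : fieldType).

Record hopfAlgType := HopfAlg {
  hopf_alg :> pzAlgType F;
  Delta : hopf_alg -> tensor hopf_alg hopf_alg;
  counit : hopf_alg -> F;
  antipode : hopf_alg -> hopf_alg;
  Delta_morphism : alg_morphism Delta;
  counit_scalar : scalar counit;
  counit_monoid : monoid_morphism counit;
  Delta_coassoc : forall h,
    tassoc (tmap Delta id (Delta h)) = tmap id Delta (Delta h);
  Delta_counitl : forall h, tlift (fun h1 h2 : hopf_alg => counit h1 *: h2) (Delta h) = h;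
  Delta_counitr : forall h, tlift (fun h1 h2 : hopf_alg => counit h2 *: h1) (Delta h) = h;
  antipode_linear : linear antipode;
  antipodel : forall h,
    tlift (fun h1 h2 : hopf_alg => antipode h1 * h2) (Delta h) = counit h *: (1 : hopf_alg);
  antipoder : forall h,
    tlift (fun h1 h2 : hopf_alg => h1 * antipode h2) (Delta h) = counit h *: (1 : hopf_alg)
}.

Definition cocommutative (H : hopfAlgType) : Prop :=
  forall h : H, tswap (Delta h) = Delta h.

Definition subcoalgebra (H : hopfAlgType) (X : H -> Prop) : Prop :=
  subspace X /\ forall x, X x ->
    lspan (fun t => exists u v, [/\ X u, X v & t = tens u v]) (Delta x).
Definition simple_subcoalgebra (H : hopfAlgType) (X : H -> Prop) : Prop :=
  [/\ subcoalgebra X, exists2 x, X x & x <> 0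
    & forall Y : H -> Prop, subcoalgebra Y -> (forall y, Y y -> X y) ->
      (exists2 y, Y y & y <> 0) -> forall x, X x -> Y x].
Definition pointed (H : hopfAlgType) : Prop :=
  forall X : H -> Prop, simple_subcoalgebra X ->
    exists2 x, x <> 0 & forall y, X y <-> exists a : F, y = a *: x.

Definition grouplike (H : hopfAlgType) (g : H) : Prop :=
  Delta g = tens g g /\ counit g = 1.
Definition primitive (H : hopfAlgType) (x : H) : Prop :=
  Delta x = tens x (1 : H) + tens (1 : H) x.

Definition coalg_morphism (H K : hopfAlgType) (f : H -> K) : Prop :=
  [/\ linear f, forall h, Delta (f h) = tmap f f (Delta h)
    & forall h, counit (f h) = counit h].
Definition hopf_morphism (H K : hopfAlgType) (f : H -> K) : Prop :=
  [/\ alg_morphism f, coalg_morphism f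
    & forall h, antipode (f h) = f (antipode h)].
End HopfAlgebras.

Section OrthogonalModules.
Context (F : fieldType) (H : hopfAlgType F) (V : vectType F).
Variables (act : H -> V -> V) (form : V -> V -> F).

Definition orthogonal_module : Prop :=
  [/\ alg_action act,
      bilin (form : V -> V -> F^o),
      forall v w, form v w = form w v,
      forall v, (forall w, form v w = 0) -> v = 0
    & forall h v w, tlift (fun h1 h2 : H => form (act h1 v) (act h2 w) : F^o) (Delta h)
                    = counit h * form v w].

Definition dual_bases (e f : (\dim {:V}).-tuple V) : Prop :=
  [/\ basis_of fullv e, basis_of fullv f
    & forall i j, form e`_i f`_j = (i == j)%:R].

Definition act_det (h : H) : F :=
  \det (passmx.mxof (vbasis {:V}) (vbasis {:V}) (linfun (act h))).

(* The Z/2-grading of H in which group-likes have degree det and primitives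
   are even. *)
Inductive hopf_deg : bool -> H -> Prop :=
| hopf_deg_grouplike (b : bool) (g : H) :
    grouplike g -> act_det g = (-1) ^+ b -> hopf_deg b g
| hopf_deg_primitive x : primitive x -> hopf_deg false x
| hopf_deg_0 b : hopf_deg b 0
| hopf_deg_lin b (a : F) x y : hopf_deg b x -> hopf_deg b y -> hopf_deg b (a *: x + y)
| hopf_deg_mul b c x y : hopf_deg b x -> hopf_deg c y ->
    hopf_deg (addb b c) (x * y).

Section Smash.
Context (B : pzAlgType F) (gen : V -> B).
Definition smash : pzAlgType F :=
  quotAlg (fun r : freeProd B H => exists h v,
    r = freeProdr B h * freeProdl H (gen v)
        - tlift (fun h1 h2 : H => freeProdl H (gen (act h1 v)) * freeProdr B h2)
                (Delta h)).
Definition smash_gen (v : V) : smash := qalg _ (freeProdl H (gen v)).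
Definition smash_hopf (h : H) : smash := qalg _ (freeProdr B h).
End Smash.

(* A linear map from the exterior square of V is an alternating bilinear map. *)
Definition alternating (kappa : V -> V -> H) : Prop :=
  bilin kappa /\ forall v, kappa v v = 0.

Section Hecke.
Variable kappa : V -> V -> H.

Let TH := smash (@tens_gen F V).
Let TH_gen := smash_gen (@tens_gen F V).
Let TH_hopf := smash_hopf (@tens_gen F V).

Definition hecke : pzAlgType F :=
  quotAlg (fun r : TH => exists v w,
    r = TH_gen v * TH_gen w - TH_gen w * TH_gen v - TH_hopf (kappa v w)).
Definition hecke_gen (v : V) : hecke := qalg _ (TH_gen v).
Definition hecke_hopf (h : H) : hecke := qalg _ (TH_hopf h).

Definition hecke_word (vs : seq V) (h : H) : hecke :=
  (\prod_(v <- vs) hecke_gen v) * hecke_hopf h.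
(* [hecke_lt n] is the step of degree [n - 1] of the filtration induced by the
   word length in T(V), elements of H having degree 0; [hecke_lt 0] is zero. *)
Definition hecke_lt (n : nat) : hecke -> Prop :=
  lspan (fun a => exists vs h, (size vs < n)%N /\ a = hecke_word vs h).

(* The associated graded space: finitely supported families whose [n]-th
   component lies in [F_n / F_(n-1)], seen inside [hecke / F_(n-1)]. *)
Definition hecke_gr (y : forall n, quotMod (hecke_lt n)) : Prop :=
  (exists N, forall n, (N <= n)%N -> y n = 0) /\
  forall n, exists2 a, hecke_lt n.+1 a & y n = qmod _ a.

(* [phi] is the natural map from S(V) # H to the associated graded space: it
   is determined by its values on the words [v_1 .. v_n h]. *)
Definition PBW : Prop :=
  exists phi : smash (@sym_gen F V) -> forall n, quotMod (hecke_lt n),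
  [/\ forall n, linear (phi ^~ n),
      forall vs h n,
        phi ((\prod_(v <- vs) smash_gen (@sym_gen F V) v)
             * smash_hopf (@sym_gen F V) h) n
        = if n == size vs then qmod _ (hecke_word vs h) else 0,
      forall x, (forall n, phi x n = 0) -> x = 0
    & forall y, hecke_gr y -> exists x, forall n, phi x n = y n].
End Hecke.
End OrthogonalModules.

Section PinCover.
Context (F : fieldType) (H : hopfAlgType F) (V : vectType F).
Variables (act : H -> V -> V) (form : V -> V -> F).
Context (tH : hopfAlgType F).
Variables (pi : tH -> H) (gamma : tH -> clifford form).

Definition reflection (v w : V) : V := w - (2 * form v w) *: v.

(* [p] is an element of Pin(V) whose image in O(V) is [f]. Products of unit
   vectors exhaust Pin(V), since unit vectors are their own inverses in C(V). *)
Definition pin_over (p : clifford form) (f : V -> V) : Prop :=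
  exists vs : seq V, [/\ forall v, v \in vs -> form v v = 1,
    p = \prod_(v <- vs) cl_gen form v & forall w, f w = foldr reflection w vs].

Definition cover_deg : bool -> tH -> Prop := hopf_deg (fun h => act (pi h)).

Record pin_cover : Prop := PinCover {
  pin_pointed : pointed tH;
  pin_cocommutative : cocommutative tH;
  pin_morphism : hopf_morphism pi;
  pin_surjective : forall h, exists th, pi th = h;
  pin_gamma_morphism : alg_morphism gamma;
  pin_double : exists j0 j1 : H -> tH,
    [/\ coalg_morphism j0, coalg_morphism j1,
        forall x, exists! p : H * H, x = j0 p.1 + j1 p.2
      & bijective (fun h => pi (j0 h)) /\ bijective (fun h => pi (j1 h))];
  pin_gamma_deg : forall b h, cover_deg b h -> cl_deg b (gamma h);
  pin_twisted : forall b h v, cover_deg b h ->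
    (-1) ^+ b *: cl_gen form (act (pi h) v)
    = tlift (fun h1 h2 : tH => gamma h1 * cl_gen form v * gamma (antipode h2))
            (Delta h);
  (* The group-likes of tH form the pullback of G(H) -> O(V) <- Pin(V). *)
  pin_grouplike : forall g, grouplike g -> pin_over (gamma g) (act (pi g));
  pin_pullback : forall g p, grouplike g -> pin_over p (act g) ->
    exists! tg, [/\ grouplike tg, pi tg = g & gamma tg = p];
  (* [pi] identifies the primitives of tH with those of H. *)
  pin_primitive : forall x, primitive x ->
    exists! tx, primitive tx /\ pi tx = x;
  pin_gamma_primitive : forall x, primitive x ->
    lspan (fun c => exists v w, c = cl_gen form v * cl_gen form w
                                    - cl_gen form w * cl_gen form v) (gamma x) /\
    forall u, gamma x * cl_gen form u - cl_gen form u * gamma x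
              = cl_gen form (act (pi x) u)
}.

Section Dirac.
Variable kappa : V -> V -> H.

Let A := hecke act kappa.
Let C := clifford form.

Definition AC_deg (b : bool) : tensor A C -> Prop :=
  lspan (fun t => exists (a : A) (c : C), cl_deg b c /\ t = tens a c).

Definition dirac (e f : (\dim {:V}).-tuple V) : tensor A C :=
  \sum_(i < \dim {:V}) tens (hecke_gen act kappa e`_i) (cl_gen form f`_i).

Definition DeltaC (h : tH) : tensor A C :=
  tlift (fun h1 h2 => tens (hecke_hopf act kappa (pi h1)) (gamma h2)) (Delta h).

Definition Hprime : pzAlgType F := quotAlg (fun h : tH => DeltaC h = 0).
(* The map induced by [DeltaC] on tH / ker DeltaC. *)
Definition DeltaC' (y : Hprime) : tensor A C := DeltaC (qrepr y).

Definition parthasarathy (D : tensor A C) : Prop :=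
  exists c h, [/\ central c, cover_deg false h & D * D = c + DeltaC h].

Definition AC_det (x : tensor A C) : Prop :=
  forall b h, cover_deg b h ->
    tlift (fun h1 h2 : tH => DeltaC h1 * x * DeltaC (antipode h2)) (Delta h)
    = ((-1) ^+ b * counit h) *: x.

(* [zeta] is used on the center of A only; its values elsewhere are
   irrelevant. *)
Record is_zeta (D : tensor A C) (zeta : A -> Hprime) : Prop := IsZeta {
  zeta_central : forall z, central z -> central (zeta z);
  zeta_linear : forall (a : F) z z', central z -> central z' ->
    zeta (a *: z + z') = a *: zeta z + zeta z';
  zeta_mul : forall z z', central z -> central z' ->
    zeta (z * z') = zeta z * zeta z';
  zeta_one : zeta 1 = 1;
  zeta_dirac : forall z, central z ->
    exists a, [/\ AC_deg true a, AC_det a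
      & tens z (1 : C) = DeltaC' (zeta z) + D * a + a * D]
}.

Section Cohomology.
Context (M S : lmodType F).
Variables (actM : A -> M -> M) (actS : C -> S -> S) (D : tensor A C).

Let op : tensor A C -> tensor M S -> tensor M S := tensor_action actM actS.

(* [M (x) S] modulo [ker D] meet [im D]; Dirac cohomology is the subspace of
   the classes of elements of [ker D]. An element of H' acts on a class through
   a representative, which is well defined on Dirac cohomology. *)
Definition dirac_quot : lmodType F :=
  quotMod (fun x => op D x = 0 /\ exists y, x = op D y).
Definition dirac_cohomology (u : dirac_quot) : Prop :=
  exists2 x, op D x = 0 & u = qmod _ x.
Definition cohomology_action (y : Hprime) (u : dirac_quot) : dirac_quot :=
  qmod _ (op (DeltaC' y) (qrepr u)).

Definition cohomology_submodule (U : dirac_quot -> Prop) : Prop :=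
  [/\ subspace U, forall u, U u -> dirac_cohomology u
    & forall y u, U u -> U (cohomology_action y u)].
End Cohomology.
End Dirac.
End PinCover.

(* Main.v *)
Require Import Defs.
From mathcomp Require Import all_boot all_order all_algebra.

Set Implicit Arguments.
Unset Strict Implicit.
Unset Printing Implicit Defensive.

Import GRing.Theory.
Local Open Scope ring_scope.

(** The tensor product of an [A]-module and a [B]-module is a module over the
    algebra [tensor A B], so the Dirac element [D] and the image of [DeltaC]
    act on [M (x) S] ([tensor_actionP]). Let [u] be a class in [U], let [x] be a representative of
    [u] with [D x = 0], and let [a] be the element with
    [z (x) 1 = DeltaC (zeta z) + D a + a D]. Apply both sides to [x]: the left
    one acts by [chi z], and [a D] kills [x], so that
      [chi z *: x - DeltaC (zeta z) x = D (a x)].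
    It remains to see that this element of [im D] also lies in [ker D], for it
    then vanishes in Dirac cohomology. As [D x = 0], this says that
    [DeltaC (zeta z) x] lies in [ker D]. It does because [U] is a submodule:
    the class of [DeltaC (zeta z) x] is again in [U], hence is a class of
    cocycles, and representatives of one class differ by an element of
    [ker D] ([cocycle_class_repr]); [homotopy_scalar_class] then concludes. *)

Lemma linear_fun0 (F : fieldType) (U V : lmodType F) (f : U -> V) :
  linear f -> f 0 = 0.
Proof. by move=> fl; have := fl (-1) 0 0; rewrite scaler0 addr0 scaleN1r addNr. Qed.

Lemma linear_comp (F : fieldType) (U V W : lmodType F) (f : V -> W) (g : U -> V) :
  linear f -> linear g -> linear (fun u => f (g u)).
Proof. by move=> fl gl a u v; rewrite gl fl. Qed.

Lemma tens_ext (F : fieldType) (U V W : lmodType F) (f g : tensor U V -> W) :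
  linear f -> linear g -> (forall u v, f (tens u v) = g (tens u v)) -> f =1 g.
Proof.
move=> fl gl fg; elim/tens_ind => [|a u v t IH]; first by rewrite !linear_fun0.
by rewrite fl gl IH fg.
Qed.

Section TensorModule.
Context (F : fieldType) (A B : pzAlgType F) (M N : lmodType F).
Variables (actM : A -> M -> M) (actN : B -> N -> N).
Hypotheses (M_mod : alg_action actM) (N_mod : alg_action actN).

Lemma tens_comp_bilin (U V U' V' : lmodType F) (f : U -> U') (g : V -> V') :
  linear f -> linear g -> bilin (fun u v => tens (f u) (g v)).
Proof.
move=> fl gl; have [tl tr] := tens_bilin U' V'.
by split=> [v a u1 u2|u a v1 v2]; rewrite ?fl ?gl ?tl ?tr.
Qed.

Lemma tens_act_bilin (a : A) (b : B) :
  bilin (fun m n => tens (actM a m) (actN b n)).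
Proof.
have [[_ Ml] _ _] := M_mod; have [[_ Nl] _ _] := N_mod.
exact: tens_comp_bilin.
Qed.

Lemma tmap_act_bilin (x : tensor M N) :
  bilin (fun a b => tmap (actM a) (actN b) x).
Proof.
have [[Ml _] _ _] := M_mod; have [[Nl _] _ _] := N_mod.
have [tl tr] := tens_bilin M N.
split=> [b|a] c p q; rewrite /tmap -tlift_linear_fun; apply: tlift_eq => m n.
  by rewrite Ml tl.
by rewrite Nl tr.
Qed.

Lemma tensor_action_tens (a : A) (b : B) (x : tensor M N) :
  tensor_action actM actN (tens a b) x = tmap (actM a) (actN b) x.
Proof. by rewrite /tensor_action tlift_tens //; apply: tmap_act_bilin. Qed.

Lemma tensor_action_bilin : bilin (tensor_action actM actN).
Proof.
split=> [x|t]; first exact/tlift_linear/tmap_act_bilin.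
move=> c x y; rewrite /tensor_action -tlift_linear_fun; apply: tlift_eq => a b.
exact/tlift_linear/tens_act_bilin.
Qed.

Let op := tensor_action actM actN.
Let opl x : linear (op^~ x). Proof. exact: tensor_action_bilin.1. Qed.
Let opr t : linear (op t). Proof. exact: tensor_action_bilin.2. Qed.
Let op_tens a b m n : op (tens a b) (tens m n) = tens (actM a m) (actN b n).
Proof.
rewrite /op tensor_action_tens /tmap tlift_tens //; exact: tens_act_bilin.
Qed.

Lemma tensor_action_mul s t x : op (tmul s t) x = op s (op t x).
Proof.
have [_ _ MM] := M_mod; have [_ _ NM] := N_mod.
(* Both sides are linear in s, t and x, so pure tensors suffice. *)
apply: (@tens_ext _ _ _ _ (fun s => op (tmul s t) x) (op^~ (op t x))) => [||a b].
- exact: linear_comp (opl x) (tmulPl t).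
- exact: opl.
apply: (@tens_ext _ _ _ _ (fun t => op (tmul (tens a b) t) x)
  (fun t => op (tens a b) (op t x))) => [||a' b'].
- exact: linear_comp (opl x) (tmulPr (tens a b)).
- exact: linear_comp (opr (tens a b)) (opl x).
apply: (@tens_ext _ _ _ _ (op (tmul (tens a b) (tens a' b')))
  (fun x => op (tens a b) (op (tens a' b') x))) => [||m n].
- exact: opr.
- exact: linear_comp (opr (tens a b)) (opr (tens a' b')).
by rewrite tmul_tens !op_tens MM NM.
Qed.

(** With [c = 1] this gives the action of the unit; with [c = chi a] it turns a
    central character of [M] into a scalar action on the tensor product. *)
Lemma tensor_action_scalar (a : A) (c : F) (x : tensor M N) :
  (forall m, actM a m = c *: m) -> op (tens a (1 : B)) x = c *: x.
Proof.
have [tl _] := tens_bilin M N; have [_ N1 _] := N_mod.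
move=> ac; apply: (@tens_ext _ _ _ _ (op (tens a (1 : B))) ( *:%R c)) => [||m n].
- exact: opr.
- by move=> d y y'; rewrite scalerDr !scalerA mulrC.
by have := tl n (c - 1) m m; rewrite op_tens ac N1 !scalerBl !scale1r !subrK.
Qed.

Lemma tensor_actionP : alg_action (tensor_action actM actN).
Proof.
have [_ M1 _] := M_mod.
split=> [|x|s t x]; [exact: tensor_action_bilin | | exact: tensor_action_mul].
rewrite -[RHS]scale1r; apply: tensor_action_scalar => m.
by rewrite M1 scale1r.
Qed.
End TensorModule.

Section Homotopy.
Context (F : fieldType) (T : pzAlgType F) (X : lmodType F) (op : T -> X -> X).
Hypothesis op_mod : alg_action op.
Variable D : T.

Let cobound (x : X) : Prop := op D x = 0 /\ exists y, x = op D y.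

(** Two representatives of a class differ by an element of [cobound], hence of
    [ker D]. This applies to the representative [qrepr u], on which the action
    of [H'] is defined and about which nothing else is known. *)
Lemma cocycle_class_repr (x y : X) :
  op D x = 0 -> qmod cobound y = qmod cobound x -> op D y = 0.
Proof.
have [[_ opr] _ _] := op_mod => Dx /qmod_eq; rewrite -{2}[y](subrK x).
move: (y - x) => k; elim=> [|a v w [Dv _] _ IH]; first by rewrite add0r.
by rewrite -addrA opr Dv scaler0 add0r.
Qed.

(** Applied to the cocycle [x], the term [a * D] vanishes, so that
    [c *: x - op d x = op D (op a x)]; this boundary is itself a cocycle because
    both terms on the left are. *)
Lemma homotopy_scalar_class (s d a : T) (c : F) (x : X) :
  s = d + D * a + a * D -> op s x = c *: x ->
  op D x = 0 -> op D (op d x) = 0 ->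
  qmod cobound (op d x) = c *: qmod cobound x.
Proof.
have [[opl opr] _ opM] := op_mod => sE sx Dx Ddx.
have opD t t' v : op (t + t') v = op t v + op t' v.
  by have := opl v 1 t t'; rewrite !scale1r.
have op0 t : op t 0 = 0 := linear_fun0 (opr t).
have dE : c *: x - op d x = op D (op a x).
  by rewrite -sx sE !opD !opM Dx op0 addr0 addrC addKr.
apply/esym; rewrite -qmodZ; apply/qmod_eq/lspan_incl; split.
  by rewrite addrC -scaleN1r opr Ddx scaler0 add0r -[c *: x]addr0 opr Dx op0
    scaler0 addr0.
by exists (op a x).
Qed.
End Homotopy.

Theorem theorem1p2
  (F : fieldType) (charF0 : [pchar F] =i pred0)
  (* the pointed cocommutative Hopf algebra H and the orthogonal module V *)
  (H : hopfAlgType F) (H_cocomm : cocommutative H) (H_pointed : pointed H)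
  (V : vectType F) (act : H -> V -> V) (form : V -> V -> F)
  (V_orth : orthogonal_module act form)
  (* the Hopf-Hecke algebra A = hecke act kappa *)
  (kappa : V -> V -> H) (kappa_alt : alternating kappa)
  (A_PBW : PBW act kappa)
  (* the pin cover *)
  (tH : hopfAlgType F) (pi : tH -> H) (gamma : tH -> clifford form)
  (tH_pin : pin_cover act pi gamma)
  (* the Dirac element and the Barbasch-Sahi condition *)
  (e f : (\dim {:V}).-tuple V) (ef_dual : dual_bases form e f)
  (D_parthasarathy : parthasarathy pi gamma (dirac act form kappa e f))
  (zeta : hecke act kappa -> Hprime act pi gamma kappa)
  (zetaP : is_zeta (dirac act form kappa e f) zeta)
  (* the spin module S and the A-module M with central character chi *)
  (S : lmodType F) (actS : clifford form -> S -> S) (S_spin : simple_module actS)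
  (M : vectType F) (actM : hecke act kappa -> M -> M) (M_mod : alg_action actM)
  (chi : hecke act kappa -> F)
  (chiP : forall z m, central z -> actM z m = chi z *: m)
  (HD_neq0 : exists2 u : dirac_quot actM actS (dirac act form kappa e f),
               dirac_cohomology u & u <> 0)
  (* the submodule U of the Dirac cohomology *)
  (U : dirac_quot actM actS (dirac act form kappa e f) -> Prop)
  (U_sub : cohomology_submodule pi gamma U)
  (U_neq0 : exists2 u, U u & u <> 0) :
  forall z : hecke act kappa, central z -> forall u, U u ->
    cohomology_action (zeta z) u = chi z *: u.
Proof.
move=> z zC u Uu; have [S_mod _ _] := S_spin.
have op_mod := tensor_actionP M_mod S_mod.
have [_ U_coc U_stable] := U_sub.
have [x Dx ux] := U_coc u Uu; rewrite -[u]qreprK in ux.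
have Du := cocycle_class_repr op_mod Dx ux.
have [x' Dx' x'E] := U_coc _ (U_stable (zeta z) u Uu).
(* Stability of U is what makes DeltaC (zeta z) applied to [qrepr u] a cocycle. *)
have Dzu := cocycle_class_repr op_mod Dx' x'E.
have [a [_ _ zE]] := zeta_dirac zetaP zC.
have zS := tensor_action_scalar M_mod S_mod (qrepr u) (chiP z ^~ zC).
by rewrite -[in RHS](qreprK u) -(homotopy_scalar_class op_mod zE zS Du Dzu).
Qed.
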